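(* For every integer $n\ge 4$, the $n$-vertex tournaments $T$ maximizing $I(C_4,T)$ among all $n$-vertex tournaments are precisely the tournaments in the class $\mathcal{C}_n$ of carousels on $n$ vertices. Consequently, $i(C_4)=\frac12$, and for every $n$, \[ I(C_4,n)=\begin{cases}\dfrac{n(n^2-1)(n-3)}{48} & \text{if } n \text{ is odd},\\[2mm] \dfrac{n(n^2-4)(n-3)}{48} & \text{if } n \text{ is even}.\end{cases} \]
   Context: A tournament is an orientation of a (finite) complete graph. For tournaments $H$ and $T$, $I(H,T)$ denotes the number of vertex subsets of $T$ that induce a tournament isomorphic to $H$. For a positive integer $n$, $I(H,n)=\max I(H,T)$, where the maximum is over all tournaments $T$ on $n$ vertices. For $n\ge |H|$ (where $|H|$ is the number of vertices of $H$), $i(H,n)=I(H,n)/\binom{n}{|H|}$, and the inducibility of $H$ is $i(H)=\lim_{n\to\infty} i(H,n)$; this limit exists since $i(H,n)$ is monotone decreasing in $n$. Carousels: for $n\ge 3$, a tournament $T$ on $n$ vertices belongs to the class $\mathcal{C}_n$ if its vertices can be labeled $v_1,v_2,\ldots,v_n$ such that $v_iv_j\in E(T)$ (i.e., the arc between $v_i$ and $v_j$ is directed from $v_i$ to $v_j$) whenever $0<j-i<\frac n2$ or $-n<j-i<-\frac n2$. (For even $n$, the arcs between $v_i$ and $v_{i+n/2}$ may be directed arbitrarily.) $C_4$ denotes the tournament on $4$ vertices which is, up to isomorphism, the unique member of $\mathcal{C}_4$; explicitly, it is the tournament on $\{1,2,3,4\}$ with arcs $1\to2$, $1\to3$, $4\to1$,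 $2\to3$, $4\to2$, $3\to4$. (It is a tournament, not merely an oriented 4-cycle.) *)

(* Defs.v *)
From HB Require Import structures.
From mathcomp Require Import all_boot all_order all_algebra.
From mathcomp Require Import all_classical all_reals all_analysis.

Set Implicit Arguments.
Unset Strict Implicit.
Unset Printing Implicit Defensive.

Import Order.TTheory GRing.Theory Num.Theory numFieldNormedType.Exports.

Local Open Scope ring_scope.

(* [(x, y) \in E] means that the arc between x and y goes from x to y. *)
Definition is_tournament (V : finType) (E : {set V * V}) : bool :=
  [forall x, (x, x) \notin E] &&
  [forall x, forall y, (x != y) ==> (((x, y) \in E) (+) ((y, x) \in E))].

Record tournament (V : finType) := Tournament {
  arcs : {set V * V};
  _ : is_tournament arcs }.

HB.instance Definition _ (V : finType) := [isSub for @arcs V].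
HB.instance Definition _ (V : finType) := [Finite of tournament V by <:].

Definition dominates (V : finType) (T : tournament V) : rel V :=
  fun x y => (x, y) \in arcs T.

Definition isomorphic (U V : finType) (H : tournament U) (T : tournament V) :
    bool :=
  [exists f : {ffun U -> V},
    [&& injectiveb f, [forall y, exists x, f x == y] &
        [forall x, forall y, dominates H x y == dominates T (f x) (f y)]]].

Definition subtournament_arcs (V : finType) (T : tournament V) (S : {set V}) :
    {set {x : V | x \in S} * {x : V | x \in S}} :=
  [set p | dominates T (val p.1) (val p.2)]%SET.

Lemma subtournament_is_tournament (V : finType) (T : tournament V) (S : {set V}) :
  is_tournament (subtournament_arcs T S).
Proof.
case: T => E ET; have /andP[/forallP irr /forallP tot] := ET; apply/andP; split.
  by apply/forallP => x; rewrite inE; exact: irr.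
apply/forallP => x; apply/forallP => y; apply/implyP => xy; rewrite !inE.
by have /forallP/(_ (val y))/implyP := tot (val x); apply.
Qed.

Definition subtournament (V : finType) (T : tournament V) (S : {set V}) :
    tournament {x : V | x \in S} :=
  Tournament (subtournament_is_tournament T S).

(* I(H, T) *)
Definition copies (U V : finType) (H : tournament U) (T : tournament V) : nat :=
  #|[set S : {set V} | isomorphic H (subtournament T S)]%SET|.

(* I(H, n) *)
Definition max_copies (U : finType) (H : tournament U) (n : nat) : nat :=
  \max_(T : tournament 'I_n) copies H T.

(* i(H, n); only meaningful for n >= #|U|, the value being 0 below. *)
Definition max_density (R : realType) (U : finType) (H : tournament U)
    (n : nat) : R :=
  (max_copies H n)%:R / 'C(n, #|U|)%:R.

(* i(H) *)
Definition inducibility (R : realType) (U : finType) (H : tournament U) : R :=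
  limn (max_density R H).

(* The class C_n.  The labels are 0, ..., n-1 instead of 1, ..., n, which does
   not affect the differences j - i. *)
Definition carousel (n : nat) (V : finType) (T : tournament V) : Prop :=
  (3 <= n)%N /\
  exists v : 'I_n -> V, bijective v /\
    forall i j : 'I_n, let d : rat := j%:R - i%:R in
      (0 < d < n%:R / 2) || (- n%:R < d < - (n%:R / 2)) -> dominates T (v i) (v j).

(* The vertices 1, 2, 3, 4 are renamed 0, 1, 2, 3. *)
Definition C4_arcs : {set 'I_4 * 'I_4} :=
  [set p | (val p.1, val p.2) \in
    [:: (0, 1); (0, 2); (3, 0); (1, 2); (3, 1); (2, 3)]%N]%SET.

Lemma C4_is_tournament : is_tournament C4_arcs.
Proof.
apply/andP; split; first by apply/forallP => -[[|[|[|[|//]]]] ?]; rewrite inE.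
apply/forallP => -[[|[|[|[|//]]]] ?]; apply/forallP => -[[|[|[|[|//]]]] ?];
  by rewrite !inE.
Qed.

Definition C4 : tournament 'I_4 := Tournament C4_is_tournament.

(* Main.v *)
(* A cyclic triangle together with a fourth vertex spans either a C_4, which
   arises from two such pairs, or a cone: a triangle inside the out- or
   in-neighbourhood of the fourth vertex.  The number of cyclic triangles
   depends only on the imbalances d^+(x) - d^-(x), so that
     48 C_4(T) + 8 cones(T) + 3 (n - 3) sum_x (d^+(x) - d^-(x))^2
       = n (n^2 - 1) (n - 3),
   where the triangle of a cone is ordered.  As imbalances are odd when n is
   even, the maximisers are the almost regular tournaments without cones.  These
   are the carousels: without cones the neighbourhoods of a vertex v0 are
   transitive, and listing v0, its out-neighbours and its in-neighbours in their
   transitive orders gives a carousel labelling, because each out-neighbour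
   dominates an initial segment of the in-neighbours, whose length is governed by
   its out-degree. *)
Require Import Defs.
From HB Require Import structures.
From mathcomp Require Import all_boot all_order all_algebra.
From mathcomp Require Import all_classical all_reals all_analysis.
From mathcomp Require Import zify ring lra.

Set Implicit Arguments.
Unset Strict Implicit.
Unset Printing Implicit Defensive.

Import Order.TTheory GRing.Theory Num.Theory numFieldNormedType.Exports.

Local Open Scope ring_scope.

(** * Counting cyclic and transitive triangles, cones and [C4] patterns *)

Section Counting.
Variables (V : finType) (T : tournament V).
Local Notation e := (dominates T).
Local Open Scope nat_scope.

Lemma dominates_irr x : e x x = false.
Proof. by have /andP[/forallP/(_ x)/negbTE] := valP T. Qed.

Lemma dominates_tot x y : x != y -> e y x = ~~ e x y.
Proof.
have /andP[_ /forallP/(_ x)/forallP/(_ y)/implyP h] := valP T.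
by move=> /h; rewrite /dominates; case: (_ \in _); case: (_ \in _).
Qed.

Lemma dominates_neq x y : e x y -> x != y.
Proof. by case: eqP => // ->; rewrite dominates_irr. Qed.

Lemma dominates_asym x y : e x y -> e y x = false.
Proof. by move=> h; rewrite dominates_tot ?h // dominates_neq. Qed.

Definition cyclic3 x y z := [&& e x y, e y z & e z x].
Definition transitive3 x y z := [&& e x y, e y z & e x z].
Definition C4_pattern a b c d :=
  [&& e a b, e a c, e d a, e b c, e d b & e c d].
Definition beats3 w x y z := [&& e w x, e w y & e w z].
Definition beaten3 w x y z := [&& e x w, e y w & e z w].

Definition outdeg x := \sum_y e x y.
Definition indeg x := \sum_y e y x.

Definition num_cyclic3 := \sum_x \sum_y \sum_z cyclic3 x y z.
Definition num_C4 := \sum_a \sum_b \sum_c \sum_d C4_pattern a b c d.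
(* The ordered cyclic triangles contained in a common out- or
   in-neighbourhood. *)
Definition num_cone := \sum_x \sum_y \sum_z \sum_w
  (cyclic3 x y z && (beats3 w x y z || beaten3 w x y z)).

(** Off the triangle, [w] beats three, two, one or none of its vertices. Three or none gives a cone.
    Beating exactly two makes [w] the first vertex of a pattern, beating exactly one the second,
    since the cyclic triangles of [C4_pattern a b c d] are those omitting [a] or [b]. The rotations
    record which vertex of the triangle is exceptional. *)
Lemma cyclic3_extensions x y z w :
  cyclic3 x y z = cyclic3 x y z * ((w == x) + (w == y) + (w == z)) +
    (cyclic3 x y z && (beats3 w x y z || beaten3 w x y z)) +
    (C4_pattern w x y z + C4_pattern w y z x + C4_pattern w z x y +
     C4_pattern x w y z + C4_pattern y w z x + C4_pattern z w x y) :> nat.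
Proof.
rewrite /cyclic3 /C4_pattern /beats3 /beaten3.
case: (eqVneq w x) => [->|wx].
  case: (eqVneq x y) => [->|xy]; first by rewrite !dominates_irr /= ?andbF.
  case: (eqVneq x z) => [->|xz]; first by rewrite !dominates_irr /= ?andbF.
  rewrite !dominates_irr /= ?andbF.
  by case: (e x y); case: (e y z); case: (e z x).
case: (eqVneq w y) => [->|wy].
  case: (eqVneq y z) => [->|xz]; first by rewrite !dominates_irr /= ?andbF.
  rewrite !dominates_irr /= ?andbF.
  by case: (e x y); case: (e y z); case: (e z x).
case: (eqVneq w z) => [->|wz].
  rewrite !dominates_irr /= ?andbF.
  by case: (e x y); case: (e y z); case: (e z x).
rewrite (dominates_tot wx) (dominates_tot wy) (dominates_tot wz).
by case: (e x y); case: (e y z); case: (e z x); case: (e w x); case: (e w y);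
  case: (e w z).
Qed.

Lemma sum_eq1 (u : V) : \sum_w (w == u) = 1.
Proof. by rewrite (bigD1 u) //= eqxx big1 // => w /negbTE ->. Qed.

Lemma sum3_rot (F : V -> V -> V -> nat) :
  \sum_x \sum_y \sum_z F y z x = \sum_x \sum_y \sum_z F x y z.
Proof.
rewrite exchange_big; apply: eq_bigr => y _.
by rewrite exchange_big.
Qed.

Lemma sum4_rot (F : V -> V -> V -> V -> nat) :
  \sum_x \sum_y \sum_z \sum_w F w x y z =
  \sum_x \sum_y \sum_z \sum_w F x y z w.
Proof.
rewrite [RHS]exchange_big; apply: eq_bigr => x _ /=.
exact/esym/(sum3_rot (fun y z w => F w x y z)).
Qed.

(** Sum [cyclic3_extensions] over all quadruples: each of the six pattern terms contributes [num_C4]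
    once its variables are permuted. *)
Lemma num_cyclic3_extend :
  num_cyclic3 * #|V| = num_cyclic3 * 3 + num_cone + 6 * num_C4.
Proof.
have H1 : \sum_x \sum_y \sum_z \sum_w C4_pattern w x y z = num_C4.
  exact: (sum4_rot (fun x y z w => C4_pattern x y z w)).
have H2 : \sum_x \sum_y \sum_z \sum_w C4_pattern w y z x = num_C4.
  by rewrite -H1; exact: (sum3_rot (fun x y z => \sum_w C4_pattern w x y z)).
have H3 : \sum_x \sum_y \sum_z \sum_w C4_pattern w z x y = num_C4.
  by rewrite -H2; exact: (sum3_rot (fun x y z => \sum_w C4_pattern w y z x)).
have K1 : \sum_x \sum_y \sum_z \sum_w C4_pattern x w y z = num_C4.
  apply: eq_bigr => x _; apply/esym.
  exact: (sum3_rot (fun y z w => C4_pattern x w y z)).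
have K2 : \sum_x \sum_y \sum_z \sum_w C4_pattern y w z x = num_C4.
  by rewrite -K1; exact: (sum3_rot (fun x y z => \sum_w C4_pattern x w y z)).
have K3 : \sum_x \sum_y \sum_z \sum_w C4_pattern z w x y = num_C4.
  by rewrite -K2; exact: (sum3_rot (fun x y z => \sum_w C4_pattern y w z x)).
have -> : 6 * num_C4 =
    num_C4 + num_C4 + num_C4 + num_C4 + num_C4 + num_C4 by lia.
rewrite -{1}H1 -{1}H2 -{1}H3 -{1}K1 -{1}K2 -{1}K3.
rewrite /num_cyclic3 /num_cone !big_distrl -!big_split /=.
apply: eq_bigr => x _; rewrite !big_distrl -!big_split /=.
apply: eq_bigr => y _; rewrite !big_distrl -!big_split /=.
apply: eq_bigr => z _.
have -> : cyclic3 x y z * 3 =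
    \sum_w cyclic3 x y z * ((w == x) + (w == y) + (w == z)).
  by rewrite -big_distrr /= !big_split /= !sum_eq1.
rewrite mulnC -sum_nat_const -!big_split /=; apply: eq_bigr => w _.
by rewrite {1}(cyclic3_extensions x y z w) !addnA.
Qed.

Lemma outdeg_indeg x : outdeg x + indeg x + 1 = #|V|.
Proof.
rewrite -sum1_card /outdeg /indeg -big_split /= (bigD1 x) //= !dominates_irr.
rewrite [RHS](bigD1 x) //= addnC add0n add1n; congr _.+1.
apply: eq_bigr => y; rewrite eq_sym => xy.
by rewrite (dominates_tot xy); case: (e x y).
Qed.

Lemma sum_outdeg_indeg : \sum_x outdeg x = \sum_x indeg x.
Proof. exact: exchange_big. Qed.

Definition num_transitive3 := \sum_x \sum_y \sum_z transitive3 x y z.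

(** Both sides count paths x -> y -> z, on the left by their middle vertex. The arc between the ends
    closes each path to a transitive or a cyclic triangle. *)
Lemma sum_indeg_outdeg :
  \sum_y indeg y * outdeg y = num_transitive3 + num_cyclic3.
Proof.
rewrite /num_transitive3 /num_cyclic3 -big_split /=.
under [RHS]eq_bigr do rewrite -big_split.
rewrite /= exchange_big; apply: eq_bigr => y _.
rewrite big_distrl; apply: eq_bigr => x _.
rewrite big_distrr -big_split; apply: eq_bigr => z _ /=.
rewrite /transitive3 /cyclic3.
case: (eqVneq x z) => [->|xz].
  by case: (boolP (e z y)) => // /dominates_asym ->.
by rewrite (dominates_tot xz); case: (e x y); case: (e y z); case: (e x z).
Qed.

(** The square counts ordered pairs of out-neighbours of [x]. Distinct ones span a transitive
    triangle with source [x], met once in each order; equal ones give the linear term. *)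
Lemma sum_outdeg_sqr :
  \sum_x outdeg x * outdeg x = 2 * num_transitive3 + \sum_x outdeg x.
Proof.
rewrite mul2n -addnn /num_transitive3 -!big_split /=; apply: eq_bigr => x _.
rewrite [X in _ = _ + X + _]exchange_big -!big_split big_distrl.
apply: eq_bigr => y _; rewrite big_distrr -big_split /=.
rewrite [X in _ = _ + X](_ : _ = \sum_z (e x y && (z == y))); last first.
  under eq_bigr do rewrite -mulnb.
  by rewrite -big_distrr /= sum_eq1 muln1.
rewrite -big_split; apply: eq_bigr => z _ /=; rewrite /transitive3.
case: (eqVneq z y) => [->|zy].
  by rewrite dominates_irr; case: (e x y).
by rewrite (dominates_tot zy); case: (e x y); case: (e z y); case: (e x z).
Qed.

Lemma sum_indeg_sqr :
  \sum_x indeg x * indeg x = 2 * num_transitive3 + \sum_x indeg x.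
Proof.
rewrite /num_transitive3.
have -> : \sum_x \sum_y \sum_z transitive3 x y z =
          \sum_z \sum_y \sum_x transitive3 x y z.
  rewrite exchange_big [RHS]exchange_big; apply: eq_bigr => y _.
  exact: exchange_big.
rewrite mul2n -addnn -!big_split /=; apply: eq_bigr => z _.
rewrite [X in _ = _ + X + _]exchange_big -!big_split big_distrl.
apply: eq_bigr => y _; rewrite big_distrr -big_split /=.
rewrite [X in _ = _ + X](_ : _ = \sum_x (e y z && (x == y))); last first.
  under eq_bigr do rewrite -mulnb.
  by rewrite -big_distrr /= sum_eq1 muln1.
rewrite -big_split; apply: eq_bigr => x _ /=; rewrite /transitive3.
case: (eqVneq x y) => [->|xy].
  by rewrite dominates_irr; case: (e y z).
by rewrite (dominates_tot xy); case: (e x z); case: (e x y); case: (e y z).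
Qed.

End Counting.

(** * Induced copies of [C4] as ordered patterns *)

Section Copies.
Variables (V : finType) (T : tournament V).
Local Notation e := (dominates T).
Local Open Scope nat_scope.

Lemma isomorphic_C4P (S : {set V}) :
  reflect (exists a b c d, C4_pattern T a b c d /\ S = [set a; b; c; d]%SET)
          (isomorphic C4 (subtournament T S)).
Proof.
apply: (iffP existsP) => [[f /and3P[_ /forallP fsurj /forallP fe]]|].
  pose i0 : 'I_4 := inord 0; pose i1 : 'I_4 := inord 1.
  pose i2 : 'I_4 := inord 2; pose i3 : 'I_4 := inord 3.
  have Eij i j : (i, j) \in C4_arcs -> e (val (f i)) (val (f j)).
    move=> ij; have /forallP/(_ j)/eqP := fe i.
    rewrite [dominates C4 _ _]ij [dominates (subtournament _ _) _ _]inE /=.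
    by move=> <-.
  exists (val (f i0)), (val (f i1)), (val (f i2)), (val (f i3)); split.
    by rewrite /C4_pattern !Eij // inE /= !inordK.
  apply/setP => x; apply/idP/idP => [xS|].
    have /existsP[i /eqP fi] := fsurj (Sub x xS).
    have -> : x = val (f i) by rewrite fi.
    have : i \in [:: i0; i1; i2; i3].
      by rewrite !inE -!val_eqE /= !inordK //; case: i {fi} => -[|[|[|[|]]]].
    by rewrite !inE -!orbA => /or4P[] /eqP ->; rewrite eqxx ?orbT.
  by rewrite !inE -!orbA => /or4P[] /eqP ->; exact: valP.
case=> a [b [c [d [/and5P[ab ac da bc /andP[db cd]] ->]]]].
pose t := [tuple a; b; c; d].
have tS i : tnth t i \in [set a; b; c; d]%SET.
  by case: i => -[|[|[|[|//]]]] ?; rewrite (tnth_nth a) !inE /= eqxx ?orbT.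
exists [ffun i => Sub (tnth t i) (tS i)].
have [ba ca] := (dominates_asym ab, dominates_asym ac).
have [ad cb] := (dominates_asym da, dominates_asym bc).
have [bd dc] := (dominates_asym db, dominates_asym cd).
apply/and3P; split.
- apply/injectiveP => i j; rewrite !ffunE => /(congr1 val) /=.
  rewrite !(tnth_nth a) => /eqP; rewrite nth_uniq //= => [/eqP /val_inj //|].
  rewrite !inE !negb_or (eq_sym a d) (eq_sym b d) andbT.
  by rewrite !(@dominates_neq _ T _ _ ab, @dominates_neq _ T _ _ ac,
    @dominates_neq _ T _ _ da, @dominates_neq _ T _ _ bc,
    @dominates_neq _ T _ _ db, @dominates_neq _ T _ _ cd).
- apply/forallP => -[x xS]; apply/existsP.
  have x_abcd : [|| x == a, x == b, x == c | x == d].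
    by have := xS; rewrite !inE -!orbA.
  case/or4P: x_abcd => /eqP xE;
  [exists (inord 0)|exists (inord 1)|exists (inord 2)|exists (inord 3)];
  by rewrite ffunE -val_eqE /= (tnth_nth a) inordK //= xE.
apply/forallP => -[i Hi]; apply/forallP => -[j Hj].
rewrite /dominates /= !inE !ffunE /= !(tnth_nth a) /=.
by case: i Hi => [|[|[|[|//]]]] Hi; case: j Hj => [|[|[|[|//]]]] Hj /=;
  rewrite -/(e _ _) ?dominates_irr ?ab ?ba ?ac ?ca ?da ?ad ?bc ?cb ?bd ?db
    ?cd ?dc.
Qed.

(** [C4] is rigid: its out-degrees 2, 1, 1, 2 together with the arcs d -> a and b -> c identify
    every vertex. Hence a vertex set carries at most one pattern, which is the injectivity of
    [g]. *)
Lemma copies_C4 : copies C4 T = num_C4 T.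
Proof.
pose P (t : V * V * V * V) := C4_pattern T t.1.1.1 t.1.1.2 t.1.2 t.2.
pose g (t : V * V * V * V) := [set t.1.1.1; t.1.1.2; t.1.2; t.2]%SET.
have -> : num_C4 T = #|[set t | P t]%SET|.
  rewrite -sum1dep_card big_mkcond /= /num_C4 !pair_big /=.
  by apply: eq_bigr => -[[[a b] c] d] _ /=; rewrite /P; case: ifP.
rewrite -(@card_in_imset _ _ g).
  apply: eq_card => S; rewrite inE; apply/isomorphic_C4P/imsetP.
    by case=> a [b [c [d [Pt ->]]]]; exists (a, b, c, d); rewrite ?inE.
  by case=> -[[[a b] c] d]; rewrite inE => Pt ->; exists a, b, c, d.
move=> [[[a b] c] d] [[[a' b'] c'] d']; rewrite !inE /P /g /=.
case/and5P=> ab ac da bc /andP[db cd].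
have [ba ca] := (dominates_asym ab, dominates_asym ac).
have [ad cb] := (dominates_asym da, dominates_asym bc).
have [bd dc] := (dominates_asym db, dominates_asym cd).
case/and5P=> a'b' a'c' d'a' b'c' /andP[d'b' c'd'] /setP eqS.
have cases x : x \in [set a'; b'; c'; d']%SET ->
    [\/ x = a, x = b, x = c | x = d].
  by rewrite -eqS !inE -!orbA => /or4P[] /eqP;
    [constructor 1|constructor 2|constructor 3|constructor 4].
have := cases a'; have := cases b'; have := cases c'; have := cases d'.
rewrite !inE !eqxx ?orbT => /(_ isT) Hd /(_ isT) Hc /(_ isT) Hb /(_ isT) Ha.
have irr := dominates_irr T.
(* Of all assignments of the primed vertices to [a], [b], [c], [d], only the identity respects the
   arcs. *)
case: Ha a'b' a'c' d'a' => ->; case: Hb b'c' d'b' => ->;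
  rewrite ?irr ?ba ?ca ?ad ?cb ?bd ?dc //;
  case: Hc c'd' => ->; rewrite ?irr ?ba ?ca ?ad ?cb ?bd ?dc //;
  case: Hd => ->; rewrite ?irr ?ba ?ca ?ad ?cb ?bd ?dc //.
Qed.

End Copies.

(** * The counting identity, the upper bound and its equality case *)

Definition max_copies48 (n : nat) : int :=
  n%:Z * (n%:Z ^+ 2 - (if odd n then 1 else 4)) * (n%:Z - 3).

Section Extremal.
Variables (V : finType) (T : tournament V).
Local Notation n := (#|V|%:Z).

Definition imbalance (x : V) : int := (outdeg T x)%:Z - (indeg T x)%:Z.

Lemma C4_identity :
  48 * (num_C4 T)%:Z + 8 * (num_cone T)%:Z +
    3 * (n - 3) * (\sum_x imbalance x ^+ 2) = n * (n ^+ 2 - 1) * (n - 3).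
Proof.
have Ec := num_cyclic3_extend T.
pose D : int := \sum_x (outdeg T x)%:Z.
have PozS (F : V -> nat) : \sum_x (F x)%:Z = (\sum_x F x)%N%:Z.
  by rewrite (big_morph _ PoszD (erefl 0%Z)).
have ED : \sum_x (indeg T x)%:Z = D.
  by rewrite /D !PozS sum_outdeg_indeg.
pose A : int := \sum_x (outdeg T x)%:Z ^+ 2.
pose B : int := \sum_x (indeg T x)%:Z ^+ 2.
pose C : int := \sum_x (indeg T x)%:Z * (outdeg T x)%:Z.
have EA : A = 2 * (num_transitive3 T)%:Z + D.
  rewrite /A /D; under eq_bigr do rewrite expr2 -PoszM.
  by rewrite !PozS sum_outdeg_sqr PoszD PoszM.
have EB : B = 2 * (num_transitive3 T)%:Z + D.
  rewrite /B -ED; under eq_bigr do rewrite expr2 -PoszM.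
  by rewrite !PozS sum_indeg_sqr PoszD PoszM.
have EC : C = (num_transitive3 T)%:Z + (num_cyclic3 T)%:Z.
  rewrite /C; under eq_bigr do rewrite -PoszM.
  by rewrite PozS sum_indeg_outdeg PoszD.
have EQ : \sum_x imbalance x ^+ 2 = A + B - 2 * C.
  rewrite /A /B /C big_distrr -sumrN -!big_split; apply: eq_bigr => x _ /=.
  rewrite /imbalance; ring.
have deg x : n = (outdeg T x)%:Z + (indeg T x)%:Z + 1.
  by rewrite -(outdeg_indeg T x) !PoszD.
have sum1 (c : int) : \sum_(x : V) c = n * c.
  by rewrite sumr_const -mulr_natl natz.
(* This is the square of n = d^+ + d^- + 1 summed over the vertices. It eliminates the cube of n,
   leaving an identity in the triangle counts, [D] and n. *)
have En3 : n * n ^+ 2 = A + B + 2 * C + 2 * D + 2 * D + n * 1.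
  rewrite -(sum1 (n ^+ 2)) -(sum1 1) -{2}ED /A /B /C /D !big_distrr -!big_split.
  by apply: eq_bigr => x _ /=; rewrite (deg x); ring.
have Ec' : (num_cyclic3 T)%:Z * (n - 3) = (num_cone T)%:Z + 6 * (num_C4 T)%:Z.
  move/(congr1 Posz): Ec; rewrite !PoszD !PoszM => Ec; rewrite mulrBr Ec; ring.
have -> : 48 * (num_C4 T)%:Z + 8 * (num_cone T)%:Z =
    8 * ((num_cyclic3 T)%:Z * (n - 3)) by rewrite Ec'; ring.
rewrite EQ; have -> : n * (n ^+ 2 - 1) = n * n ^+ 2 - n by ring.
rewrite En3 EA EB EC; ring.
Qed.

Lemma imbalance_parity x : (~~ odd #|V|)%:Z <= imbalance x ^+ 2.
Proof.
rewrite /imbalance expr2; have := outdeg_indeg T x.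
case: (boolP (odd _)) => /= h H.
  by rewrite -expr2 sqr_ge0.
(* Equal degrees would make n = 2 d^+ + 1 odd. *)
have : (outdeg T x)%:Z - (indeg T x)%:Z <> 0.
  by move=> ?; move: h; rewrite -H; lia.
by move: (_ - _) => d; nia.
Qed.

(** As d^+ + d^- = n - 1, the imbalance is 2 d^+ - n + 1, so these bounds say that it lies between
    -1 and 1. *)
Definition almost_regular :=
  [forall x, (#|V| <= 2 * outdeg T x + 2)%N && (2 * outdeg T x <= #|V|)%N].

Lemma almost_regularP :
  reflect (forall x, imbalance x ^+ 2 = (~~ odd #|V|)%:Z) almost_regular.
Proof.
apply: (iffP forallP) => H x; have := H x; have := outdeg_indeg T x;
  rewrite /imbalance expr2 => E.
  case/andP => h1 h2.
  have : [\/ (outdeg T x)%:Z - (indeg T x)%:Z = 0,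
     (outdeg T x)%:Z - (indeg T x)%:Z = 1 |
     (outdeg T x)%:Z - (indeg T x)%:Z = -1].
    have : `|(outdeg T x)%:Z - (indeg T x)%:Z| <= 1 by lia.
    by case: (_ - _) => -[|[|k]] //;
      [constructor 1|constructor 2|constructor 3].
  by case=> d0; rewrite d0 -E; lia.
move=> h; have : ((outdeg T x)%:Z - (indeg T x)%:Z) *
    ((outdeg T x)%:Z - (indeg T x)%:Z) <= 1.
  by rewrite h; case: odd.
move=> h'; apply/andP; split; nia.
Qed.

(** Each squared imbalance is replaced by its excess over the least value its parity permits. For
    even n this moves 3 n (n - 3) to the right-hand side and turns the factor n^2 - 1 into n^2 -
    4. *)
Lemma copies48_identity : 48 * (copies C4 T)%:Z + 8 * (num_cone T)%:Z +
  3 * (n - 3) * (\sum_x (imbalance x ^+ 2 - (~~ odd #|V|)%:Z)) =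
  max_copies48 #|V|.
Proof.
rewrite copies_C4 big_split /= sumr_const mulrDr addrA C4_identity.
rewrite /max_copies48.
by rewrite mulNrn -mulr_natl natz; case: odd => /=; ring.
Qed.

Hypothesis n_ge4 : (4 <= #|V|)%N.

Lemma copies_C4_le : 48 * (copies C4 T)%:Z <= max_copies48 #|V|.
Proof.
rewrite -copies48_identity -addrA lerDl addr_ge0 // mulr_ge0 //; first lia.
by apply: sumr_ge0 => x _; rewrite subr_ge0 imbalance_parity.
Qed.

(** The deficit consists of nonnegative terms, and n - 3 is positive, so it vanishes only if there
    are no cones and every squared imbalance is minimal. *)
Lemma copies_C4_eq :
  (48 * (copies C4 T)%:Z == max_copies48 #|V|) =
  (num_cone T == 0)%N && almost_regular.
Proof.
have S0 x : 0 <= imbalance x ^+ 2 - (~~ odd #|V|)%:Z.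
  by rewrite subr_ge0 imbalance_parity.
rewrite -copies48_identity -addrA -subr_eq0 opprD addNKr oppr_eq0.
have n3_gt0 : 0 < n - 3 by lia.
rewrite paddr_eq0 //; last by rewrite !mulr_ge0 ?sumr_ge0 ?ltW.
rewrite !mulf_eq0 (gt_eqF n3_gt0) psumr_eq0 //=.
congr andb; apply/allP/almost_regularP => H x.
  by have := H x; rewrite mem_index_enum => /(_ isT); rewrite subr_eq0 => /eqP.
by move=> _; rewrite H subrr.
Qed.

End Extremal.

(** * Carousel labellings, and why carousels are cone-free and almost regular *)

Lemma num_cone_eq0P (V : finType) (T : tournament V) :
  reflect (forall x y z w, cyclic3 T x y z ->
             ~~ beats3 T w x y z && ~~ beaten3 T w x y z)
          (num_cone T == 0%N).
Proof.
rewrite /num_cone; apply: (iffP eqP) => [H x y z w cxyz|H].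
  move/eqP: H; rewrite sum_nat_eq0 => /forallP/(_ x)/=.
  rewrite sum_nat_eq0 => /forallP/(_ y)/=.
  rewrite sum_nat_eq0 => /forallP/(_ z)/=.
  by rewrite sum_nat_eq0 => /forallP/(_ w)/=; rewrite cxyz eqb0 negb_or.
do 4![apply: big1 => ? _]; apply/eqP; rewrite eqb0; apply/negP => /andP[/H h].
by rewrite -[_ || _]negbK negb_or h.
Qed.

(** The distance of two labels is compared with n/2 in doubled form, within the naturals. At
    distance exactly n/2 the arc is free. *)
Definition carousel_labelling (V : finType) (T : tournament V) (l : V -> nat) :=
  forall x y, (l x < l y)%N ->
    ((2 * l y < 2 * l x + #|V|)%N -> dominates T x y) /\
    ((2 * l x + #|V| < 2 * l y)%N -> dominates T y x).

Lemma carousel_condE (n : nat) (i j : 'I_n) (d : rat := j%:R - i%:R) :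
  (0 < d < n%:R / 2) || (- n%:R < d < - (n%:R / 2)) =
  ((i < j)%N && (2 * j < 2 * i + n)%N) || (2 * j + n < 2 * i)%N.
Proof.
have i_lt := ltn_ord i.
rewrite /d subr_gt0 ltr_nat ltr_pdivlMr // ltrNr ltr_pdivrMr // opprB.
(* This bound is automatic, as labels are less than [n]. *)
have -> : - n%:R < j%:R - i%:R :> rat.
  by rewrite ltrNl opprB ltrBlDr -natrD ltr_nat; lia.
rewrite !mulrBl ltrBlDr ltrBrDr -!natrM -!natrD !ltr_nat /=.
by congr (_ && _ || _); lia.
Qed.

Lemma carouselP (V : finType) (T : tournament V) :
  carousel #|V| T <-> (3 <= #|V|)%N /\
    exists l : V -> 'I_#|V|, injective l /\ carousel_labelling T l.
Proof.
split=> [|[n3 [l [linj lT]]]]; last first.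
  split=> //.
  have [v lv vl] : bijective l by apply: inj_card_bij; rewrite ?card_ord.
  exists v; split; first by exists l.
  move=> i j d; rewrite carousel_condE => /orP[/andP[ij h]|h].
    by have := lT (v i) (v j); rewrite !vl => /(_ ij)[+ _]; apply.
  have ji : (j < i)%N by lia.
  by have := lT (v j) (v i); rewrite !vl => /(_ ji)[_]; apply; lia.
case=> n3 [v [[l vl lv] vT]]; split=> //; exists l.
split; first exact: can_inj lv.
have {}vT x y : ((l x < l y)%N && (2 * l y < 2 * l x + #|V|)%N) ||
    (2 * l y + #|V| < 2 * l x)%N -> dominates T x y.
  move=> h; rewrite -[x]lv -[y]lv; apply: vT.
  by rewrite carousel_condE.
move=> x y xy; split=> h; apply: vT; first by rewrite xy h.
by rewrite h orbT.
Qed.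

(** The [m] labels that follow [i] around the circle, [m] being (n - 1)/2 rounded down, all satisfy
    the condition, and n <= 2 m + 2. The map [p] lists them, reduced modulo [n]. *)
Lemma cyclic_window (n : nat) (i : 'I_n) :
  (n <= 2 * (\sum_(j < n)
    ((i < j) && (2 * j < 2 * i + n) || (2 * j + n < 2 * i))) + 2)%N.
Proof.
pose m := n.-1./2.
have m_def : (2 * m <= n.-1 <= 2 * m + 1)%N by rewrite /m; lia.
have i_lt := ltn_ord i.
pose p (k : 'I_m) := (if i + k + 1 < n then i + k + 1 else i + k + 1 - n)%N.
have p_lt k : (p k < n)%N by rewrite /p; have := ltn_ord k; case: ifP; lia.
pose f k : 'I_n := Ordinal (p_lt k).
have finj : injective f.
  move=> k k' /(congr1 val) /= pkk'; apply: val_inj => /=; move: pkk'.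
  by have := ltn_ord k; have := ltn_ord k'; rewrite /p; do 2![case: ifP]; lia.
have : (#|f @: 'I_m| <= \sum_(j < n)
    ((i < j) && (2 * j < 2 * i + n) || (2 * j + n < 2 * i)))%N.
  rewrite -sum1_card big_mkcond /=; apply: leq_sum => j _.
  case: ifP => // /imsetP[k _ ->]; rewrite lt0b /= /p.
  by have := ltn_ord k; case: ifP; lia.
rewrite card_imset // card_ord => h.
lia.
Qed.

Section Labelled.
Variables (V : finType) (T : tournament V) (l : V -> 'I_#|V|).
Hypotheses (linj : injective l) (lT : carousel_labelling T l).
Local Notation e := (dominates T).
Local Open Scope nat_scope.

Lemma labelled_arc x y : e x y ->
  (l x < l y /\ 2 * l y <= 2 * l x + #|V|) \/
  (l y < l x /\ 2 * l y + #|V| <= 2 * l x).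
Proof.
move=> xy; have [lxy|lyx|/val_inj/linj exy] := ltngtP (l x) (l y).
- left; split=> //; rewrite leqNgt; apply/negP => /((lT lxy).2) yx.
  by rewrite (dominates_asym xy) in yx.
- right; split=> //; rewrite leqNgt; apply/negP => /((lT lyx).1) yx.
  by rewrite (dominates_asym xy) in yx.
by rewrite exy dominates_irr in xy.
Qed.

(** Every arc advances by at most n/2 around the circle of labels. The triangle of a cone would lie
    in the half circle just after or just before the fourth vertex, so one of its arcs would have to
    advance by more than n/2. *)
Lemma labelled_num_cone : num_cone T = 0.
Proof.
apply/eqP/num_cone_eq0P => x y z w /and3P[/labelled_arc xy /labelled_arc yz].
move=> /labelled_arc zx.
have := (ltn_ord (l x), ltn_ord (l y), ltn_ord (l z), ltn_ord (l w)).
case=> [[[lx ly] lz] lw]; apply/andP; split; apply/negP;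
  by case/and3P=> /labelled_arc ? /labelled_arc ? /labelled_arc ?; lia.
Qed.

Lemma labelled_almost_regular : almost_regular T.
Proof.
have lbij : bijective l by apply: inj_card_bij; rewrite ?card_ord.
have [v lv vl] := lbij.
apply/forallP => x.
have out_arc y : (l x < l y) && (2 * l y < 2 * l x + #|V|) ||
    (2 * l y + #|V| < 2 * l x) -> e x y.
  case/orP=> [/andP[xy h]|h]; first exact: (lT xy).1.
  have yx : l y < l x by lia.
  exact: (lT yx).2.
(* Reversing the labels exchanges in- and out-neighbours, so [cyclic_window] bounds both degrees
   from below. Since they add up to n - 1, the upper bound follows. *)
have in_arc y : (rev_ord (l x) < rev_ord (l y)) &&
    (2 * rev_ord (l y) < 2 * rev_ord (l x) + #|V|) ||
    (2 * rev_ord (l y) + #|V| < 2 * rev_ord (l x)) -> e y x.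
  have [lx ly] := (ltn_ord (l x), ltn_ord (l y)).
  have revE z : rev_ord (l z) = #|V| - (l z).+1 :> nat by [].
  rewrite !revE; case/orP=> [/andP[xy h]|h].
    have yx : l y < l x by lia.
    by apply: (lT yx).1; lia.
  have xy : l x < l y by lia.
  by apply: (lT xy).2; lia.
have out_ge : #|V| <= 2 * outdeg T x + 2.
  apply: leq_trans (cyclic_window (l x)) _; rewrite leq_add2r leq_mul2l /=.
  rewrite /outdeg (reindex l) /=; last exact: onW_bij.
  by apply: leq_sum => y _; case: (boolP (_ || _)) => // /out_arc ->.
have in_ge : #|V| <= 2 * indeg T x + 2.
  apply: leq_trans (cyclic_window (rev_ord (l x))) _.
  rewrite leq_add2r leq_mul2l /=.
  rewrite /indeg (reindex (@rev_ord _ \o l)) /=; last first.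
    apply: onW_bij; apply: bij_comp => //.
    by exists (@rev_ord _); exact: rev_ordK.
  by apply: leq_sum => y _; case: (boolP (_ || _)) => // /in_arc ->.
have := outdeg_indeg T x; lia.
Qed.

End Labelled.

(** * A carousel labelling of a cone-free almost regular tournament *)

Section Rank.
Variables (V : finType) (T : tournament V) (v0 : V).
Local Notation e := (dominates T).
Local Open Scope nat_scope.
Hypothesis cone0 : num_cone T = 0.

(* The vertices in the order v0, a_1, .., a_p, b_1, .., b_q, where
   a_1 -> .. -> a_p are the out-neighbours of v0 and b_1 -> .. -> b_q its
   in-neighbours. *)
Definition before x y :=
  if x == v0 then y != v0 else
  if e v0 x then e y v0 || e x y && e v0 y else e x y && e y v0.

Let vertexP x : [\/ x = v0, x != v0 /\ (e v0 x /\ e x v0 = false) |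
                    x != v0 /\ (e x v0 /\ e v0 x = false)].
Proof.
case: (eqVneq x v0) => [->|xv]; first by constructor 1.
have := dominates_tot T xv; case: (e x v0) => ->.
  by constructor 3.
by constructor 2.
Qed.

Let no_cone x y z w : e x y -> e y z -> e z x ->
  ~~ (e w x && e w y && e w z) /\ ~~ (e x w && e y w && e z w).
Proof.
move=> xy yz zx; have /eqP/num_cone_eq0P/(_ x y z w) := cone0.
by rewrite /cyclic3 /beats3 /beaten3 xy yz zx -!andbA => /(_ isT)/andP.
Qed.

Lemma before_irr x : before x x = false.
Proof.
rewrite /before dominates_irr; case: (eqVneq x v0) => // _.
by case: ifP => // /dominates_asym ->.
Qed.

Lemma before_total x y : x != y -> before y x = ~~ before x y.
Proof.
move=> xy; rewrite /before; have yx := dominates_tot T xy.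
case: (vertexP x) => [xE|[xv [vx xv']]|[xv [vx xv']]];
  case: (vertexP y) => [yE|[yv [vy yv']]|[yv [vy yv']]]; subst;
  rewrite ?eqxx ?(negbTE xv) ?(negbTE yv) ?vx ?vy ?xv' ?yv' ?dominates_irr //=
    ?andbT ?andbF ?orbF ?orbT //.
by rewrite eqxx in xy.
Qed.

(** Apart from immediate cases, all three vertices are out-neighbours of [v0], or all three are
    in-neighbours. A failure would then be a cyclic triangle forming a cone with [v0]. *)
Lemma before_trans y x z : before x y -> before y z -> before x z.
Proof.
case: (eqVneq x z) => [->|xz].
  case: (eqVneq z y) => [->|zy]; first by rewrite before_irr.
  by rewrite (before_total zy) => ->.
have zx := dominates_tot T xz.
have [irr cone] := (dominates_irr T v0, @no_cone x y z v0).
rewrite /before.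
case: (vertexP x) => [xE|[xv [vx xv']]|[xv [vx xv']]];
  case: (vertexP y) => [yE|[yv [vy yv']]|[yv [vy yv']]];
  case: (vertexP z) => [zE|[zv [vz zv']]|[zv [vz zv']]]; subst;
  rewrite ?eqxx ?(negbTE xv) ?(negbTE yv) ?(negbTE zv) ?vx ?vy ?vz
    ?xv' ?yv' ?zv' ?irr //= ?andbT ?andbF ?orbF ?orbT // => xy yz;
  apply/negPn; rewrite -zx; apply/negP => h; have [] := cone xy yz h;
  by rewrite vx vy vz.
Qed.

(* If y is after x, the distance from x to y in this order compares with the
   out-degree of x: when x dominates y it dominates everything in between, and
   when y dominates x all out-neighbours of x are strictly between them. *)
Lemma between_dominated x y z :
  before x y -> e x y -> before x z -> before z y -> e x z.
Proof.
case: (eqVneq x z) => [->|xz]; first by rewrite before_irr.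
have zx := dominates_tot T xz.
have [irr cone] := (dominates_irr T v0, @no_cone v0 x y z).
rewrite /before.
case: (vertexP x) => [xE|[xv [vx xv']]|[xv [vx xv']]];
  case: (vertexP y) => [yE|[yv [vy yv']]|[yv [vy yv']]];
  case: (vertexP z) => [zE|[zv [vz zv']]|[zv [vz zv']]]; subst;
  rewrite ?eqxx ?(negbTE xv) ?(negbTE yv) ?(negbTE zv) ?vx ?vy ?vz
    ?xv' ?yv' ?zv' ?irr //= ?andbT ?andbF ?orbF ?orbT // => _ xy _ zy.
(* What remains has [x] among the out-neighbours of [v0] and [y], [z] among the in-neighbours. If z
   -> x, then [z] would dominate the cyclic triangle [v0], [x], [y]. *)
apply/negPn; rewrite -zx; apply/negP => h; have [] := cone vx xy vy.
by rewrite vz h zy.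
Qed.

Lemma dominated_between x y z :
  before x y -> e y x -> e x z -> before x z && before z y.
Proof.
move=> + + xz'; have xz := dominates_neq xz'.
case: (eqVneq z y) => [zy|zy] xy yx.
  by rewrite -zy (dominates_asym xz') in yx.
move: xy yx; have yz := dominates_tot T zy.
have [irr cone] := (dominates_irr T v0, @no_cone v0 x z y).
rewrite /before.
have xyas : e x y -> e y x = false := @dominates_asym _ T x y.
case: (vertexP x) => [xE|[xv [vx xv']]|[xv [vx xv']]];
  case: (vertexP y) => [yE|[yv [vy yv']]|[yv [vy yv']]];
  case: (vertexP z) => [zE|[zv [vz zv']]|[zv [vz zv']]]; subst;
  rewrite ?eqxx ?(negbTE xv) ?(negbTE yv) ?(negbTE zv) ?vx ?vy ?vz
    ?xv' ?yv' ?zv' ?irr ?xz' //= ?andbT ?andbF ?orbF ?orbT //;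
  rewrite ?vx ?vy ?vz ?xv' ?yv' ?zv' // in xz' *;
  try by move=> /xyas ->.
  by rewrite irr in xz'.
(* Here too [x] is an out-neighbour and [y], [z] are in-neighbours: y -> z would make [y] dominate
   the cyclic triangle [v0], [x], [z]. *)
move=> _ yx; apply/negPn; rewrite -yz; apply/negP => h.
by have [] := cone vx xz' vz; rewrite vy yx h.
Qed.

Definition rank x := \sum_y before y x.

Definition gap x y := \sum_z (before x z && before z y).

Lemma rank_gap x y : before x y -> rank y = rank x + 1 + gap x y.
Proof.
move=> xy; rewrite /rank /gap -(sum_eq1 x) -!big_split.
apply: eq_bigr => z _ /=.
case: (eqVneq z x) => [->|zx]; first by rewrite before_irr xy.
rewrite (before_total zx); case: (boolP (before z x)) => [zx'|_] //=.
by rewrite (before_trans zx' xy).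
Qed.

Lemma rank_lt x : rank x < #|V|.
Proof.
rewrite -sum1_card -addn1 -[X in _ + X <= _](sum_eq1 x) /rank -big_split /=.
apply: leq_sum => y _.
case: (eqVneq y x) => [->|_]; first by rewrite before_irr.
by rewrite addn0 leq_b1.
Qed.

Lemma rank_ltP x y : (rank x < rank y) = before x y.
Proof.
apply/idP/idP => [|/rank_gap ->]; last by lia.
case: (eqVneq x y) => [->|xy]; first by rewrite ltnn.
have := before_total xy; case: (before x y) => //= /rank_gap ->; lia.
Qed.

Hypothesis regT : almost_regular T.

(** The rank difference is [gap x y] + 1. If x -> y, it is at most d^+(x) <= n/2, and if y -> x, it
    is at least d^+(x) + 1 >= n/2. Hence a difference other than n/2 determines the arc. *)
Lemma rank_labelling : carousel_labelling T rank.
Proof.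
move=> x y; rewrite rank_ltP => xy; rewrite (rank_gap xy).
have neq_xy : x != y by apply: contraTneq xy => ->; rewrite before_irr.
have := dominates_tot T neq_xy.
have /andP[reg1 reg2] :
    (#|V| <= 2 * outdeg T x + 2) && (2 * outdeg T x <= #|V|) := forallP regT x.
case: (boolP (e x y)) => exy eyx; split=> // h.
  have : gap x y + 1 <= outdeg T x.
    rewrite -(sum_eq1 y) -big_split; apply: leq_sum => z _ /=.
    case: (eqVneq z y) => [->|_]; first by rewrite before_irr andbF exy.
    case: (boolP (_ && _)) => // /andP[xz zy].
    by rewrite (between_dominated xy exy xz zy).
  by lia.
have : outdeg T x <= gap x y.
  apply: leq_sum => z _; case: (boolP (e x z)) => // xz.
  by rewrite (dominated_between xy eyx xz).
by lia.
Qed.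

End Rank.

Lemma carousel_extremal (V : finType) (T : tournament V) : (3 <= #|V|)%N ->
  carousel #|V| T <-> num_cone T = 0%N /\ almost_regular T.
Proof.
move=> n3; rewrite carouselP; split=> [[_ [l [linj lT]]]|[cone0 regT]].
  by split; [exact: labelled_num_cone lT|exact: labelled_almost_regular lT].
(* Any vertex can serve as the origin of the order. *)
split=> //; have /card_gt0P[v0 _] : (0 < #|V|)%N by lia.
exists (fun x => Ordinal (rank_lt T v0 x)); split; last exact: rank_labelling.
move=> x y /(congr1 val) /= exy; apply/eqP; apply: contraT => xy.
by have := before_total T v0 xy; rewrite -!(rank_ltP _ cone0) exy ltnn.
Qed.

(** * An explicit carousel and the maximum number of copies *)

Section Existence.
Variable n : nat.
Local Open Scope nat_scope.

(** The weak inequality settles the free arcs at distance n/2: they go from the smaller to the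
    larger label. *)
Definition carousel_arcs : {set 'I_n * 'I_n} :=
  [set p : 'I_n * 'I_n | ((p.1 < p.2) && (2 * p.2 <= 2 * p.1 + n)) ||
                         (2 * p.2 + n < 2 * p.1)]%SET.

Lemma carousel_arcs_tournament : is_tournament carousel_arcs.
Proof.
apply/andP; split; apply/forallP => i; first by rewrite inE /=; lia.
apply/forallP => j; apply/implyP; rewrite -val_eqE !inE /=; lia.
Qed.

Definition carousel_tournament := Tournament carousel_arcs_tournament.

Lemma carousel_tournamentP : 3 <= n -> carousel n carousel_tournament.
Proof.
move=> n3; split=> //; exists id; split; first by exists id.
move=> i j d; rewrite carousel_condE /dominates inE /= => h.
by case/orP: h => [/andP[-> /ltnW ->]|->]; rewrite ?orbT.
Qed.

End Existence.

Lemma copies_C4_carousel (V : finType) (T : tournament V) : (4 <= #|V|)%N ->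
  48 * (copies C4 T)%:Z = max_copies48 #|V| <-> carousel #|V| T.
Proof.
move=> n4; rewrite carousel_extremal; last exact: ltnW.
split=> [/eqP|[/eqP c0 r]].
  by rewrite copies_C4_eq // => /andP[/eqP ->].
by apply/eqP; rewrite copies_C4_eq // c0.
Qed.

Lemma max_copies_C4 n : (4 <= n)%N ->
  48 * (max_copies C4 n)%:Z = max_copies48 n.
Proof.
move=> n4; apply/eqP; rewrite eq_le; apply/andP; split.
  have [|T] := @bigop.eq_bigmax _ (fun T : tournament 'I_n => copies C4 T).
    by apply/card_gt0P; exists (carousel_tournament n).
  rewrite /max_copies => ->.
  by have := @copies_C4_le _ T; rewrite card_ord; apply.
have n4' : (4 <= #|'I_n|)%N by rewrite card_ord.
have [_] := copies_C4_carousel (carousel_tournament n) n4'.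
rewrite card_ord => <- //; last by apply: carousel_tournamentP; lia.
rewrite ler_pM2l // lez_nat.
exact: (@leq_bigmax _ (fun T : tournament 'I_n => copies C4 T)).
Qed.

Lemma max_copies_C4_small n : (n < 4)%N -> max_copies C4 n = 0%N.
Proof.
move=> n4; apply: big1 => T _; apply: eq_card0 => S; rewrite inE.
apply: contraTF (n4) => /existsP[f /and3P[/injectiveP finj _ _]].
by have := leq_card _ (inj_comp val_inj finj); rewrite !card_ord -leqNgt.
Qed.

(** * The closed formula and the limit density *)

Lemma max_copies_C4_real (R : realType) (n : nat) : (0 < n)%N ->
  (max_copies C4 n)%:R =
    if odd n then n%:R * (n%:R ^+ 2 - 1) * (n%:R - 3) / 48
    else n%:R * (n%:R ^+ 2 - 4) * (n%:R - 3) / 48 :> R.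
Proof.
case: (ltnP n 4) => [n4 n0|n4 _].
  rewrite max_copies_C4_small //.
  (* For n = 1, 2, 3 the formula vanishes through the factors n^2 - 1, n^2 - 4 and n - 3
     respectively. *)
  by move: n n4 n0 => [|[|[|[|]]]] //= _ _; field.
have /(congr1 (fun z : int => z%:~R : R)) := max_copies_C4 n4.
rewrite /max_copies48 !(rmorphM, rmorphB, rmorphXn) /= -!pmulrn => H.
apply: (@mulfI _ 48); rewrite ?pnatr_eq0 //.
by case: odd H => /= ->; field.
Qed.

(** With n = k + 4 the binomial coefficient is nonzero and the density simplifies to (n + 1)/(2 (n -
    2)) for odd n and (n + 2)/(2 (n - 1)) for even n. These exceed 1/2 by 3/(2 (k + 2)) and 3/(2 (k
    + 3)), both below 3/(k + 1). *)
Lemma C4_density_bounds (R : realType) (k : nat) :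
  1 / 2 <= max_density R C4 (k + 4) <= 1 / 2 + 3 * harmonic k.
Proof.
have C24 : 24 * 'C(k + 4, 4)%:R =
    (k%:R + 4) * (k%:R + 3) * (k%:R + 2) * (k%:R + 1) :> R.
  have /(congr1 (fun m => m%:R : R)) := bin_ffact (k + 4) 4.
  rewrite addn4 !ffactnS ffactn0 /= muln1 !natrM mulrC => ->.
  by rewrite -!natr1; ring.
have k0 : 0 <= k%:R :> R by [].
have -> : max_density R C4 (k + 4) =
    if odd k then (k%:R + 5) / (2 * (k%:R + 2))
    else (k%:R + 6) / (2 * (k%:R + 3)).
  have binE : 'C(k + 4, 4)%:R =
      (k%:R + 4) * (k%:R + 3) * (k%:R + 2) * (k%:R + 1) / 24 :> R.
    by rewrite -C24 mulrC mulKf.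
  rewrite /max_density card_ord max_copies_C4_real ?addn_gt0 ?orbT // binE.
  rewrite oddD addbF natrD.
  by case: odd; field; rewrite !lt0r_neq0 //; lra.
have k1 : 0 < k%:R + 1 :> R by lra.
have -> : harmonic k = (k%:R + 1)^-1 :> R by rewrite /harmonic /= -natr1.
clear C24; case: odd; apply/andP; split.
- by rewrite ler_pdivlMr; lra.
- rewrite -subr_ge0
    (_ : _ - _ = 3 * (k%:R + 3) / (2 * (k%:R + 1) * (k%:R + 2))).
    by rewrite divr_ge0 // ?mulr_ge0 //; lra.
  by field; rewrite !lt0r_neq0 //; lra.
- by rewrite ler_pdivlMr; lra.
rewrite -subr_ge0 (_ : _ - _ = 3 * (k%:R + 5) / (2 * (k%:R + 1) * (k%:R + 3))).
  by rewrite divr_ge0 // ?mulr_ge0 //; lra.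
by field; rewrite !lt0r_neq0 //; lra.
Qed.

Lemma C4_density_cvg (R : realType) :
  (max_density R C4 @ \oo --> (1 / 2 : R))%classic.
Proof.
rewrite -(cvg_shiftn 4); apply: (@squeeze_cvgr _ _ _ _ (fun=> 1 / 2)
  (fun k => 1 / 2 + 3 * harmonic k)).
- by near=> k; exact: C4_density_bounds.
- exact: cvg_cst.
suff : (1 / 2 + 3 * harmonic k @[k --> \oo] --> (1 / 2 + 3 * 0 : R))%classic.
  by rewrite mulr0 addr0.
by apply: cvgD; [exact: cvg_cst|apply: cvgMr; exact: cvg_harmonic].
Unshelve. all: by end_near.
Qed.

Theorem theorem2 (R : realType) :
  [/\ forall (n : nat) (V : finType) (T : tournament V),
        (4 <= n)%N -> #|V| = n ->
        (copies C4 T = max_copies C4 n <-> carousel n T),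
      cvgn (max_density R C4) /\ inducibility R C4 = 1 / 2 &
      forall n : nat, (0 < n)%N ->
        (max_copies C4 n)%:R =
          if odd n then n%:R * (n%:R ^+ 2 - 1) * (n%:R - 3) / 48
          else n%:R * (n%:R ^+ 2 - 4) * (n%:R - 3) / 48 :> R].
Proof.
have cvgd := @C4_density_cvg R.
split; last exact: max_copies_C4_real.
  move=> n V T n4 Vn; subst n; rewrite -copies_C4_carousel // -max_copies_C4 //.
  split=> [->//|/mulfI H]; have /eqP := H isT.
  by rewrite eqz_nat => /eqP.
by split; [apply/cvg_ex; exists (1 / 2)|exact: cvg_lim].
Qed.
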